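(* Let $m\ge 1$, let $P$ be a set of pointers with $|P|=2m-1$, let $\pi\in S_n$ be $P$-excellent, and let $A\subseteq\mathrm{SP}(\pi)$ with $|A|=a$. Then the Sprague–Grundy number $g_{2m}(a):=\mathrm{SG}(\pi,A)$ of the game $\mathbf{CDS}(\pi,A)$ is \[ g_{2m}(a)=\begin{cases}0,& a\le m-2,\ \text{or } a=m-1 \text{ and } m \text{ odd},\\ 1,& a\ge m+1,\ \text{or } a=m \text{ and } m \text{ odd},\\ 2,& a\in\{m,m-1\} \text{ and } m \text{ even}.\end{cases} \]
   Context: Permutations $\pi\in S_n$ are written $[\pi(1)\ \cdots\ \pi(n)]$. Entry $k$ has left pointer $(k-1,k)$ and right pointer $(k,k+1)$; the pointer $(p,p+1)$ is written $p^*$. The pointer word $W(\pi)$ lists $L(\pi(1))R(\pi(1))\cdots L(\pi(n))R(\pi(n))$ with $(0,1)$ and $(n,n+1)$ removed. Two distinct pointers $p,q$ are compatible (form a valid pointer context) if their occurrences in $W(\pi)$ interleave: $p\ldots q\ldots p\ldots q$ or $q\ldots p\ldots q\ldots p$. For a valid pointer context $(p,q)$, $\mathbf{cds}_{p,q}(\pi)$ is obtained by swapping the block of entries of $\pi$ lying between the first occurrences of $p$ and $q$ in $W(\pi)$ with the block lying between their second occurrences. A pointer $r^*$ is part of an adjacency if $r+1$ immediately follows $r$ in $\pi$. A cds fixed point is a permutation with no valid pointer context; the non-identity ones are $\sigma_{n,p}=[p+1\ p+2\ \cdots\ n\ 1\ 2\ \cdots\ p]$ (note $\sigma_{n,p}(n)=p$).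 Strategic pile: with $X_n=(0\ 1\ \cdots\ n)$, $Y_\pi=(\pi(n)\ \cdots\ \pi(1)\ 0)$ in cycle notation and $C_\pi=Y_\pi\circ X_n$, $\mathrm{SP}(\pi)$ is the set of numbers after $n$ and before $0$ in the cycle of $C_\pi$ containing $0$ and $n$; a pointer $p^*$ is identified with the number $p$. The game $\mathbf{CDS}(\pi,A)$, $A\subseteq\mathrm{SP}(\pi)$: players ONE and TWO, starting with ONE, alternately apply $\mathbf{cds}$ at a valid pointer context of the current permutation until a fixed point is reached; ONE wins iff the fixed point is $\sigma_{n,a}$ for some $a\in A$. The children of $\mathbf{CDS}(\pi,A)$ are the games $\mathbf{CDS}(\mathbf{cds}_{p^*,q^*}(\pi),(\mathrm{SP}(\pi)\setminus A)\setminus\{p,q\})$ over all valid pointer contexts $(p^*,q^* )$ of $\pi$. Sprague–Grundy number: if $\pi$ is a fixed point, $\mathrm{SG}(\pi,A)=1$ if $\pi=\sigma_{n,a}$ with $a\in A$ and $0$ otherwise; else $\mathrm{SG}(\pi,A)$ is the least $j\ge0$ not equal to $\mathrm{SG}$ of any child. For a set $P$ of pointers, $\pi$ is $P$-excellent if (1) any two pointers in $P$ are compatible, (2) pointers not in $P$ are compatible with no other pointer, and (3) $\mathrm{SP}(\pi)=P$ (under the identification $p^*\leftrightarrow p$). *)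

(* Defs.v *)
From mathcomp Require Import all_boot all_fingroup finmap.
From mathcomp Require Import zify.

Set Implicit Arguments.
Unset Strict Implicit.
Unset Printing Implicit Defensive.

(* Permutations of {1, .., n} are handled in one-line notation, as words
   w : seq nat that rearrange iota 1 n; so n = size w.  The pointer
   p^* = (p, p+1) is encoded by the number p, with 0 < p < n. *)

Definition oneline n (pi : 'S_n) : seq nat := [seq (pi i).+1 | i <- enum 'I_n].

Definition is_pointer (n p : nat) : bool := 0 < p < n.

(* L(w_1) R(w_1) .. L(w_n) R(w_n), with (0,1) and (n,n+1) still present:
   letters 2i and 2i+1 are the left and right pointers of the entry of
   index i (counting from 0). *)
Definition full_pointer_word (w : seq nat) : seq nat :=
  flatten [seq [:: k.-1; k] | k <- w].

Definition pointer_word (w : seq nat) : seq nat :=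
  [seq p <- full_pointer_word w | is_pointer (size w) p].

Definition compatible (w : seq nat) (p q : nat) : bool :=
  (p != q) && (subseq [:: p; q; p; q] (pointer_word w)
               || subseq [:: q; p; q; p] (pointer_word w)).

Definition occ1 (p : nat) (u : seq nat) : nat := index p u.
Definition occ2 (p : nat) (u : seq nat) : nat :=
  (occ1 p u).+1 + index p (drop (occ1 p u).+1 u).

Definition block (i j : nat) (w : seq nat) : seq nat := drop i (take j w).

(* A letter of index j in the full pointer word has uphalf j entries of w to
   its left; hence the entries of w between the letters of indices j <= k are
   those of index i with uphalf j <= i < uphalf k.  Removing (0,1) and
   (n,n+1) does not affect which entries lie between two given letters. *)
Definition cds (p q : nat) (w : seq nat) : seq nat :=
  let u := full_pointer_word w in
  let c1 := uphalf (minn (occ1 p u) (occ1 q u)) in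
  let c2 := uphalf (maxn (occ1 p u) (occ1 q u)) in
  let c3 := uphalf (minn (occ2 p u) (occ2 q u)) in
  let c4 := uphalf (maxn (occ2 p u) (occ2 q u)) in
  take c1 w ++ block c3 c4 w ++ block c2 c3 w ++ block c1 c2 w ++ drop c4 w.

Definition contexts (w : seq nat) : seq (nat * nat) :=
  [seq c <- [seq (p, q) | p <- iota 1 (size w).-1, q <- iota 1 (size w).-1]
     | compatible w c.1 c.2].

Definition cds_fixed (w : seq nat) : bool := nilp (contexts w).

Definition sigma (n p : nat) : seq nat := iota p.+1 (n - p) ++ iota 1 p.

(* next c is the cyclic permutation with cycle notation c. *)
Definition Xperm (n : nat) : nat -> nat := next (iota 0 n.+1).
Definition Yperm (w : seq nat) : nat -> nat := next (rcons (rev w) 0).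
Definition Cperm (w : seq nat) : nat -> nat := Yperm w \o Xperm (size w).

(* n, C(n), .., C^n(n): the cycle of C containing n, possibly with
   repetitions.  The strategic pile is empty if 0 is not in that cycle. *)
Definition pile_cycle (w : seq nat) : seq nat :=
  traject (Cperm w) (size w) (size w).+1.

Definition pile (w : seq nat) : seq nat :=
  let c := pile_cycle w in
  if 0 \in c then behead (take (index 0 c) c) else [::].

Definition SP (w : seq nat) : {fset nat} := [fset x in pile w]%fset.

Definition mex (s : seq nat) : nat :=
  find (fun j => j \notin s) (iota 0 (size s).+1).

Definition child_set (w : seq nat) (A : {fset nat}) (p q : nat) : {fset nat} :=
  ((SP w `\` A) `\` [fset p; q])%fset.

Definition fixed_value (w : seq nat) (A : {fset nat}) : nat :=
  has (fun a => w == sigma (size w) a) A.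

Fixpoint SG_rec (k : nat) (w : seq nat) (A : {fset nat}) : nat :=
  if cds_fixed w then fixed_value w A
  else if k is k'.+1 then
    mex [seq SG_rec k' (cds c.1 c.2 w) (child_set w A c.1 c.2)
           | c <- contexts w]
  else 0.

(* The recursion depth size w suffices, because every cds move creates an
   adjacency; the defining equation of SG is lemma SG_eq below. *)
Definition SG (w : seq nat) (A : {fset nat}) : nat := SG_rec (size w) w A.

Definition excellent (P : {fset nat}) (w : seq nat) : Prop :=
  [/\ forall p q, p \in P -> q \in P -> p != q -> compatible w p q,
      forall p q, is_pointer (size w) p -> is_pointer (size w) q ->
        p \notin P -> ~~ compatible w p q
    & SP w = P].

Lemma mexP (s : seq nat) :
  mex s \notin s /\ forall j, j < mex s -> j \in s.
Proof.
have hasP' : has (fun j => j \notin s) (iota 0 (size s).+1).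
  apply/negPn/negP => /hasPn h.
  have sub : {subset iota 0 (size s).+1 <= s} by move=> x /h /negPn.
  by have := uniq_leq_size (iota_uniq 0 _) sub; rewrite size_iota ltnn.
have lt_mex : mex s < (size s).+1.
  by rewrite /mex -[X in _ < X](size_iota 0) -has_find.
split; first by have := nth_find 0 hasP'; rewrite nth_iota.
move=> j lt_j; have := before_find 0 lt_j.
by rewrite nth_iota ?add0n ?(ltn_trans lt_j) // => /negbFE.
Qed.

Lemma oneline_perm n (pi : 'S_n) : perm_eq (oneline pi) (iota 1 n).
Proof.
apply: uniq_perm; rewrite ?iota_uniq //.
  by rewrite map_inj_uniq ?enum_uniq // => i j [] /val_inj /perm_inj.
move=> x; rewrite mem_iota; apply/mapP/idP => [[i _ ->]|].
  by have := ltn_ord (pi i); lia.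
case: x => // x /= x_lt; have x_n : x < n by lia.
by exists ((pi^-1)%g (Ordinal x_n)); rewrite ?mem_enum // permKV.
Qed.

Lemma size_oneline n (pi : 'S_n) : size (oneline pi) = n.
Proof. by rewrite size_map size_enum_ord. Qed.

Section Termination.

Lemma size_full w : size (full_pointer_word w) = (size w).*2.
Proof. by elim: w => //= k w ->. Qed.

Lemma nth_full w j : j < (size w).*2 ->
  nth 0 (full_pointer_word w) j =
    if odd j then nth 0 w j./2 else (nth 0 w j./2).-1.
Proof.
elim: w j => [|k w IHw] [|[|j]] //= lt_j.
by rewrite IHw ?negbK //; lia.
Qed.

Lemma subseq_step (x : nat) s u : subseq (x :: s) u ->
  exists j, [/\ j < size u, nth 0 u j = x & subseq s (drop j.+1 u)].
Proof.
elim: u => //= y u IHu; case: eqP => [->|_] sub.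
  by exists 0; rewrite drop0.
by have [j [lt_j nth_j sub_j]] := IHu sub; exists j.+1.
Qed.

Lemma subseq4 (p q : nat) u : subseq [:: p; q; p; q] u ->
  exists j1 j2 j3 j4, [/\ j1 < j2 < j3, j3 < j4 < size u,
    nth 0 u j1 = p /\ nth 0 u j3 = p & nth 0 u j2 = q /\ nth 0 u j4 = q].
Proof.
move=> /subseq_step[j1 [h1 n1]] /subseq_step[j2 [h2 n2]].
move=> /subseq_step[j3 [h3 n3]] /subseq_step[j4 [h4 n4 _]].
move: h2 n2 h3 n3 h4 n4; rewrite !drop_drop !size_drop !nth_drop.
move=> h2 n2 h3 n3 h4 n4.
exists j1; eexists; eexists; eexists.
by split; [| |split; [exact: n1|exact: n3]|split; [exact: n2|exact: n4]]; lia.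
Qed.

Variables (n : nat) (w : seq nat).
Hypothesis w_perm : perm_eq w (iota 1 n).

Let size_w : size w = n.
Proof. by rewrite (perm_size w_perm) size_iota. Qed.

Let uniq_w : uniq w.
Proof. by rewrite (perm_uniq w_perm) iota_uniq. Qed.

Let mem_w x : (x \in w) = (0 < x <= n).
Proof. by rewrite (perm_mem w_perm) mem_iota; lia. Qed.

Let nth_w i : i < n -> 0 < nth 0 w i <= n.
Proof. by move=> lt_i; rewrite -mem_w mem_nth ?size_w. Qed.

Let pos x := index x w.

Let pos_lt x : 0 < x <= n -> pos x < n.
Proof. by rewrite -mem_w -index_mem size_w. Qed.

Let nth_pos x : 0 < x <= n -> nth 0 w (pos x) = x.
Proof. by rewrite -mem_w; apply: nth_index. Qed.

Let pos_nth i : i < n -> pos (nth 0 w i) = i.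
Proof. by move=> lt_i; rewrite /pos index_uniq ?size_w. Qed.

Let u := full_pointer_word w.

Let slotP p j : is_pointer n p -> j < size u ->
  nth 0 u j = p -> j = (pos p).*2.+1 \/ j = (pos p.+1).*2.
Proof.
move=> /andP[p_gt0 p_lt]; rewrite size_full size_w => lt_j.
rewrite nth_full ?size_w //; have lt_j2 : j./2 < n by lia.
have := nth_w lt_j2; case: ifP => odd_j nth_gt eq_p.
  by left; rewrite -eq_p pos_nth //; lia.
by right; rewrite -eq_p prednK ?pos_nth //; lia.
Qed.

Let occ1E p : is_pointer n p ->
  occ1 p u = minn (pos p).*2.+1 (pos p.+1).*2.
Proof.
move=> ptr_p; have /andP[p_gt0 p_lt] := ptr_p.
have lt1 : pos p < n by apply: pos_lt; lia.
have lt2 : pos p.+1 < n by apply: pos_lt; lia.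
have e1 : nth 0 u (pos p).*2.+1 = p.
  rewrite nth_full ?size_w /=; last lia.
  by rewrite odd_double /= uphalf_double nth_pos //; lia.
have e2 : nth 0 u (pos p.+1).*2 = p.
  rewrite nth_full ?size_w /=; last lia.
  by rewrite odd_double /= doubleK nth_pos //; lia.
have p_u : p \in u by rewrite -e1 mem_nth // size_full size_w; lia.
have lt_o : occ1 p u < size u by rewrite index_mem.
have := slotP ptr_p lt_o (nth_index 0 p_u).
have le1 : occ1 p u <= (pos p).*2.+1.
  by rewrite leqNgt; apply/negP => /(before_find 0) /=; rewrite e1 eqxx.
have le2 : occ1 p u <= (pos p.+1).*2.
  by rewrite leqNgt; apply/negP => /(before_find 0) /=; rewrite e2 eqxx.
lia.
Qed.

Let occ2E p : is_pointer n p ->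
  occ2 p u = maxn (pos p).*2.+1 (pos p.+1).*2.
Proof.
move=> ptr_p; have /andP[p_gt0 p_lt] := ptr_p.
have lt1 : pos p < n by apply: pos_lt; lia.
have lt2 : pos p.+1 < n by apply: pos_lt; lia.
have e1 : nth 0 u (pos p).*2.+1 = p.
  rewrite nth_full ?size_w /=; last lia.
  by rewrite odd_double /= uphalf_double nth_pos //; lia.
have e2 : nth 0 u (pos p.+1).*2 = p.
  rewrite nth_full ?size_w /=; last lia.
  by rewrite odd_double /= doubleK nth_pos //; lia.
have o1 := occ1E ptr_p; set k := maxn _ _.
have k_gt : occ1 p u < k by rewrite o1 /k; lia.
have k_lt : k < size u by rewrite size_full size_w /k; lia.
have nth_k : nth 0 u k = p by rewrite /k; case: leqP.
set v := drop (occ1 p u).+1 u.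
have p_v : p \in v.
  have lt_kv : k - (occ1 p u).+1 < size v by rewrite size_drop; lia.
  by have := mem_nth 0 lt_kv; rewrite nth_drop subnKC // nth_k.
have lt_v : index p v < size v by rewrite index_mem.
have := nth_index 0 p_v; rewrite {1}/v nth_drop => e.
have lt_o : occ2 p u < size u by move: lt_v; rewrite size_drop /occ2 -/v; lia.
have := slotP ptr_p lt_o e; have : occ1 p u < occ2 p u by rewrite /occ2; lia.
by rewrite o1 /k; lia.
Qed.

Let cds_sym p q : cds p q w = cds q p w.
Proof.
by rewrite /cds (minnC (occ1 p _)) (maxnC (occ1 p _)) (minnC (occ2 p _))
  (maxnC (occ2 p _)).
Qed.

Definition adjacent r (s : seq nat) : bool := infix [:: r; r.+1] s.

Let adjP r : adjacent r w -> is_pointer n r /\ pos r.+1 = (pos r).+1.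
Proof.
case/infixP=> s1 [s2 eq_w].
have r_w : r \in w by rewrite eq_w !mem_cat mem_head orbT.
have r1_w : r.+1 \in w by rewrite eq_w !mem_cat !inE eqxx !orbT.
split; first by move: r_w r1_w; rewrite !mem_w /is_pointer; lia.
move: uniq_w; rewrite eq_w cat_uniq => /and3P[_ /hasPn nin _].
have /negbTE n1 : r \notin s1 by apply: nin; rewrite mem_head.
have /negbTE n2 : r.+1 \notin s1 by apply: nin; rewrite !inE eqxx orbT.
rewrite /pos eq_w !index_cat n1 n2 /= eqxx.
have /negbTE -> : r != r.+1 by rewrite neq_ltn ltnSn.
by rewrite !inE !eqxx orbT addn0 addn1.
Qed.

Let infix_block r i j k : i <= k -> k.+1 < j -> j <= n ->
  nth 0 w k = r -> nth 0 w k.+1 = r.+1 -> adjacent r (block i j w).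
Proof.
move=> le_ik lt_kj le_jn nk nk1; apply/infixP.
exists (drop i (take k w)), (drop k.+2 (take j w)).
have -> : block i j w = drop i (take k w ++ drop k (take j w)).
  by rewrite /block -[in LHS](cat_take_drop k (take j w)) take_takel //; lia.
rewrite drop_cat size_takel ?size_w; last lia.
have st : size (take j w) = j by rewrite size_takel ?size_w.
have e : drop k (take j w) = [:: r, r.+1 & drop k.+2 (take j w)].
  rewrite (drop_nth 0) ?st; last lia.
  rewrite (drop_nth 0) ?st; last lia.
  by rewrite !nth_take ?nk ?nk1 //; lia.
case: ltnP => [_|le_ki]; first by rewrite e.
have -> : i = k by lia.
by rewrite subnn drop0 e [drop k (take k w)]drop_oversize ?size_takel ?size_w //; lia.
Qed.

Section Cuts.
Variables c1 c2 c3 c4 : nat.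
Hypotheses (c12 : c1 <= c2) (c23 : c2 <= c3) (c34 : c3 <= c4) (c4n : c4 <= n).
Let w' := take c1 w ++ block c3 c4 w ++ block c2 c3 w ++ block c1 c2 w
            ++ drop c4 w.

Let w_split : w = take c1 w ++ block c1 c2 w ++ block c2 c3 w ++ block c3 c4 w
            ++ drop c4 w.
Proof.
have cat_block i j k : i <= j -> j <= k -> k <= n ->
    block i j w ++ block j k w = block i k w.
  move=> le_ij le_jk le_kn; rewrite /block.
  rewrite -[in RHS](cat_take_drop j (take k w)) take_takel // drop_cat.
  rewrite size_takel ?size_w; last lia.
  case: ltnP => // le_ji; have -> : i = j by lia.
  by rewrite subnn drop0 [drop j (take j w)]drop_oversize ?size_takel ?size_w //; lia.
have b0 j : take j w = block 0 j w by rewrite /block drop0.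
rewrite b0 !catA !cat_block //; try lia.
by rewrite -b0 cat_take_drop.
Qed.

Lemma perm_cuts : perm_eq w' w.
Proof.
rewrite [X in perm_eq _ X]w_split /w' perm_cat2l !catA perm_cat2r.
by rewrite perm_catC catA perm_catC !catA perm_cat2r perm_catC.
Qed.

Lemma adjacent_cuts r k : nth 0 w k = r -> nth 0 w k.+1 = r.+1 -> k.+1 < n ->
  k.+1 \notin [:: c1; c2; c3; c4] -> adjacent r w'.
Proof.
move=> nk nk1 lt_k; rewrite !inE !negb_or => /and4P[ne1 ne2 ne3 ne4].
have ib i j : i <= k -> k.+1 < j -> j <= n -> adjacent r (block i j w).
  by move=> *; apply: infix_block nk nk1.
have tb : take c1 w = block 0 c1 w by rewrite /block drop0.
have db : drop c4 w = block c4 n w by rewrite /block -size_w take_size.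
rewrite /w' /adjacent.
have [lt1|ge1] := ltnP k.+1 c1.
  by rewrite infix_catr // tb; apply: ib; lia.
rewrite infix_catl //; have [lt2|ge2] := ltnP k.+1 c2.
  by do 2!rewrite infix_catl //; rewrite infix_catr //; apply: ib; lia.
have [lt3|ge3] := ltnP k.+1 c3.
  by rewrite infix_catl // infix_catr //; apply: ib; lia.
have [lt4|ge4] := ltnP k.+1 c4.
  by rewrite infix_catr //; apply: ib; lia.
by do 3!rewrite infix_catl //; rewrite db; apply: ib; lia.
Qed.

Let adj_join x i j k l : i < j -> j <= n -> k < l -> l <= n ->
  nth 0 w j.-1 = x -> nth 0 w k = x.+1 ->
  adjacent x (block i j w ++ block k l w).
Proof.
move=> lt_ij le_jn lt_kl le_ln nj nk.
have -> : block i j w = rcons (drop i (take j.-1 w)) x.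
  rewrite /block -{1}[j](ltn_predK lt_ij) (take_nth 0) ?size_w; last lia.
  rewrite nj -cats1 drop_cat size_takel ?size_w; last lia.
  case: ltnP => [_|le]; first by rewrite cats1.
  have -> : i = j.-1 by lia.
  rewrite subnn drop0 [drop _ (take _ w)]drop_oversize //.
  by rewrite size_takel ?size_w //; lia.
have -> : block k l w = x.+1 :: drop k.+1 (take l w).
  rewrite /block (drop_nth 0) ?size_takel ?size_w // nth_take //.
  by rewrite nk.
by rewrite cat_rcons; apply/infixP; do 2!eexists; reflexivity.
Qed.

Lemma adjacent_new1 p : 0 < c1 -> c3 < c4 ->
  nth 0 w c1.-1 = p -> nth 0 w c3 = p.+1 -> adjacent p w'.
Proof.
move=> c1_gt0 lt34 n1 n3; rewrite /adjacent /w' catA infix_catr //.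
have -> : take c1 w = block 0 c1 w by rewrite /block drop0.
by apply: adj_join => //; lia.
Qed.

Lemma adjacent_new2 p : c1 < c2 -> c2 < c3 ->
  nth 0 w c3.-1 = p -> nth 0 w c1 = p.+1 -> adjacent p w'.
Proof.
move=> lt12 lt23 n3 n1; rewrite /adjacent /w' infix_catl // infix_catl //.
by rewrite catA infix_catr //; apply: adj_join => //; lia.
Qed.

End Cuts.

Lemma compatible_pointer p q :
  compatible w p q -> is_pointer n p /\ is_pointer n q.
Proof.
case/andP=> _ h; have [] : p \in pointer_word w /\ q \in pointer_word w.
  by case/orP: h => /mem_subseq h; split; apply: h; rewrite !inE eqxx ?orbT.
by rewrite !mem_filter size_w => /andP[-> _] /andP[-> _].
Qed.

Lemma cds_spec p q : compatible w p q ->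
  [/\ perm_eq (cds p q w) (iota 1 n),
      forall r, adjacent r w -> adjacent r (cds p q w)
    & exists2 r, is_pointer n r & ~~ adjacent r w && adjacent r (cds p q w)].
Proof.
wlog sub : p q / subseq [:: p; q; p; q] (pointer_word w).
  move=> IH comp; case/andP: (comp) => neq /orP[] h; first exact: IH.
  by rewrite cds_sym; apply: IH; rewrite // /compatible eq_sym neq h.
move=> comp; have [ptr_p ptr_q] := compatible_pointer comp.
have /subseq4[j1 [j2 [j3 [j4 []]]]] :
    subseq [:: p; q; p; q] u by apply: subseq_trans sub (filter_subseq _ _).
move=> /andP[lt12 lt23] /andP[lt34 lt4].
case=> n1 n3 [n2 n4].
have [l1 l2 l3 l4] : [/\ j1 < size u, j2 < size u, j3 < size u & j4 < size u].
  have l3 := ltn_trans lt34 lt4; have l2 := ltn_trans lt23 l3.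
  by split=> //; apply: ltn_trans lt12 l2.
have s1 := slotP ptr_p l1 n1.
have s2 := slotP ptr_q l2 n2.
have s3 := slotP ptr_p l3 n3.
have s4 := slotP ptr_q l4 n4.
have o1p : occ1 p u = j1 by rewrite occ1E //; lia.
have o2p : occ2 p u = j3 by rewrite occ2E //; lia.
have o1q : occ1 q u = j2 by rewrite occ1E //; lia.
have o2q : occ2 q u = j4 by rewrite occ2E //; lia.
have [lt_p lt_p1 lt_q lt_q1] :
    [/\ pos p < n, pos p.+1 < n, pos q < n & pos q.+1 < n].
  by split; apply: pos_lt; rewrite /is_pointer in ptr_p ptr_q; lia.
have n_p : nth 0 w (pos p) = p.
  by apply: nth_pos; rewrite /is_pointer in ptr_p; lia.
have n_p1 : nth 0 w (pos p.+1) = p.+1.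
  by apply: nth_pos; rewrite /is_pointer in ptr_p; lia.
rewrite /cds -/u o1p o1q o2p o2q.
have -> : minn j1 j2 = j1 by lia.
have -> : maxn j1 j2 = j2 by lia.
have -> : minn j3 j4 = j3 by lia.
have -> : maxn j3 j4 = j4 by lia.
have [l12 l23 l34 l4n] : [/\ uphalf j1 <= uphalf j2, uphalf j2 <= uphalf j3,
    uphalf j3 <= uphalf j4 & uphalf j4 <= n] by split; lia.
have nadj_p : ~~ adjacent p w by apply/negP => /adjP[_]; lia.
split.
- exact: perm_trans (perm_cuts _ _ _ _) w_perm.
- move=> r adj_r; have [/andP[r0 rn] pos_r] := adjP adj_r.
  apply: (@adjacent_cuts _ _ _ _ _ _ _ _ r (pos r)) => //.
  + by apply: nth_pos; lia.
  + by rewrite -pos_r; apply: nth_pos; lia.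
  + by rewrite -pos_r; apply: pos_lt; lia.
  have ne s : is_pointer n s -> s != r ->
      (pos r).+1 <> (pos s).+1 /\ (pos r).+1 <> pos s.+1.
    move=> /andP[s0 sn] ne_sr; split=> e; move/eqP: ne_sr; apply.
      have {}e : pos r = pos s by lia.
      by rewrite -[s]nth_pos -?e ?nth_pos //; lia.
    have {}e : pos r.+1 = pos s.+1 by lia.
    by apply: succn_inj; rewrite -[s.+1]nth_pos -?e ?nth_pos //; lia.
  have ne_p : p != r by apply: contraNneq nadj_p => ->.
  have ne_q : q != r.
    by apply/negP => /eqP e; move: adj_r; rewrite -e => /adjP[_]; lia.
  have [a1 a2] := ne _ ptr_p ne_p; have [b1 b2] := ne _ ptr_q ne_q.
  by rewrite !inE; lia.
exists p => //; rewrite nadj_p /=.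
have [e1|e1] := s1.
  have e3 : j3 = (pos p.+1).*2 by lia.
  apply: adjacent_new1 => //; try lia.
    by rewrite -[RHS]n_p; congr nth; lia.
  by rewrite -[RHS]n_p1; congr nth; lia.
have e3 : j3 = (pos p).*2.+1 by lia.
apply: adjacent_new2 => //; try lia.
  by rewrite -[RHS]n_p; congr nth; lia.
by rewrite -[RHS]n_p1; congr nth; lia.
Qed.

End Termination.

Definition nonadjacencies (n : nat) (w : seq nat) : nat :=
  count (fun r => ~~ adjacent r w) (iota 1 n.-1).

Lemma nonadjacencies_cds n w p q : perm_eq w (iota 1 n) -> compatible w p q ->
  nonadjacencies n (cds p q w) < nonadjacencies n w.
Proof.
move=> w_perm /(cds_spec w_perm)[_ keep [r /andP[r0 rn] /andP[r_w r_cds]]].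
have r_in : r \in iota 1 n.-1 by rewrite mem_iota; lia.
rewrite /nonadjacencies; case/splitPr: r_in => s1 s2.
rewrite !count_cat /= r_w r_cds add0n add1n addnS ltnS.
by apply: leq_add; apply: sub_count => x; apply: contra; apply: keep.
Qed.

Lemma mem_contexts w c : c \in contexts w -> compatible w c.1 c.2.
Proof. by rewrite mem_filter => /andP[]. Qed.

Lemma SG_rec_stable n k k' w A : perm_eq w (iota 1 n) ->
  nonadjacencies n w <= k -> nonadjacencies n w <= k' ->
  SG_rec k w A = SG_rec k' w A.
Proof.
elim: k k' w A => [|k IHk] [|k'] w A w_perm le_k le_k' //=; case: ifP => // nfix.
- have [c /mem_contexts comp] : exists c, c \in contexts w.
    by move: nfix; rewrite /cds_fixed; case: contexts => // c s; exists c; rewrite mem_head.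
  by have := nonadjacencies_cds w_perm comp; lia.
- have [c /mem_contexts comp] : exists c, c \in contexts w.
    by move: nfix; rewrite /cds_fixed; case: contexts => // c s; exists c; rewrite mem_head.
  by have := nonadjacencies_cds w_perm comp; lia.
congr mex; apply/eq_in_map => c /mem_contexts comp.
have lt_c := nonadjacencies_cds w_perm comp.
have [c_perm _ _] := cds_spec w_perm comp.
by apply: IHk; rewrite // -ltnS; apply: leq_trans lt_c _.
Qed.

Lemma SG_eq n w A : perm_eq w (iota 1 n) ->
  SG w A =
    if cds_fixed w then fixed_value w A
    else mex [seq SG (cds c.1 c.2 w) (child_set w A c.1 c.2) | c <- contexts w].
Proof.
move=> w_perm; have size_w : size w = n by rewrite (perm_size w_perm) size_iota.
have na_le v : nonadjacencies n v <= n.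
  by apply: leq_trans (count_size _ _) _; rewrite size_iota; lia.
rewrite {1}/SG size_w (@SG_rec_stable n n n.+1) //=; last by rewrite leqW.
case: ifP => // _; congr mex; apply/eq_in_map => c /mem_contexts comp.
have [c_perm _ _] := cds_spec w_perm comp.
by rewrite /SG (perm_size c_perm) size_iota.
Qed.

(* Main.v *)
Require Import Defs.
From mathcomp Require Import all_boot all_fingroup finmap.
From mathcomp Require Import zify.

Set Implicit Arguments.
Unset Strict Implicit.
Unset Printing Implicit Defensive.

(* A pointer is a chord joining its two occurrences in the pointer word, and
   compatible means crossing.  The move cds at (p, q) is a pivot on the edge pq
   of the crossing graph: p and q become isolated, and the crossing of r and s
   is toggled iff (r crosses p and s crosses q) xor (r crosses q and s crosses p).
   On the cycle side, C_pi just loses p and q, which are bypassed.  Hence a move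
   at p, q turns a P-excellent permutation into a (P - {p, q})-excellent one, and
   the game only depends on |P| and |A|: the opponent receives b, b - 1 or b - 2
   winning pointers, where b = |P| - |A|, and mex is evaluated by induction.
   When |P| = 1 no chords cross, and the only such permutation with last entry p
   is sigma_{n,p}. *)

(** * Chords of the pointer word and their crossings *)

Definition inside (w : seq nat) (p i : nat) : bool :=
  (index p w < i) (+) (index p.+1 w <= i).

(** Parity form of interleaving. In [inside] the test is strict for [p] and weak for [p.+1], because
    the right pointer of [p] follows its entry while the left pointer of [p.+1] precedes its own. *)
Definition crossing (w : seq nat) (p r : nat) : bool :=
  inside w p (index r w) (+) inside w p (index r.+1 w).

Lemma subseq_cons_nth (x : nat) s u j :
  j < size u -> nth 0 u j = x -> subseq s (drop j.+1 u) -> subseq (x :: s) u.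
Proof.
move=> lt_j <- sub; rewrite -[u in X in subseq _ X](cat_take_drop j).
rewrite (drop_nth 0) //; apply: (@cat_subseq _ [::]); first exact: sub0seq.
by rewrite /= eqxx.
Qed.

Lemma subseq4_nth u j1 j2 j3 j4 : j1 < j2 -> j2 < j3 -> j3 < j4 ->
  j4 < size u ->
  subseq [:: nth 0 u j1; nth 0 u j2; nth 0 u j3; nth 0 u j4] u.
Proof.
move=> lt12 lt23 lt34 lt4; have lt3 := ltn_trans lt34 lt4.
have lt2 := ltn_trans lt23 lt3; have lt1 := ltn_trans lt12 lt2.
have step i j s : i < j -> j < size u -> subseq s (drop j.+1 u) ->
    subseq (nth 0 u j :: s) (drop i.+1 u).
  move=> lt_ij lt_j sub; apply: (@subseq_cons_nth _ _ _ (j - i.+1)).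
  - by rewrite size_drop ltn_sub2r // (leq_ltn_trans lt_ij).
  - by rewrite nth_drop subnKC.
  - by rewrite drop_drop addSn subnK.
by apply: subseq_cons_nth (erefl _) _ => //; do 3!apply: (step) => //; apply: sub0seq.
Qed.

Lemma interleave_sorted (u : seq nat) p q x1 x2 y1 y2 :
  (forall j, j < size u -> nth 0 u j = p -> j = x1 \/ j = x2) ->
  (forall j, j < size u -> nth 0 u j = q -> j = y1 \/ j = y2) ->
  nth 0 u x1 = p -> nth 0 u x2 = p -> nth 0 u y1 = q -> nth 0 u y2 = q ->
  x1 < x2 -> y1 < y2 -> x2 < size u -> y2 < size u ->
  subseq [:: p; q; p; q] u = [&& x1 < y1, y1 < x2 & x2 < y2].
Proof.
move=> occ_p occ_q px1 px2 qy1 qy2 lt_x lt_y lx ly; apply/idP/and3P; last first.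
  case=> h1 h2 h3; have := subseq4_nth h1 h2 h3 ly.
  by rewrite px1 px2 qy1 qy2.
case/subseq4=> [j1 [j2 [j3 [j4 []]]]] /andP[l12 l23] /andP[l34 l4].
have l3 := ltn_trans l34 l4; have l2 := ltn_trans l23 l3.
have l1 := ltn_trans l12 l2.
case=> /(occ_p _ l1) e1 /(occ_p _ l3) e3.
case=> /(occ_q _ l2) e2 /(occ_q _ l4) e4.
clear - e1 e2 e3 e4 l12 l23 l34 lt_x lt_y.
have e1' : j1 = x1 by lia.
have e3' : j3 = x2 by lia.
have e2' : j2 = y1 by lia.
have e4' : j4 = y2 by lia.
by subst; split.
Qed.

(** Interleaving means that exactly one of [y1], [y2] lies between [x1] and [x2]. Written with
    exclusive ors, the test is blind to the order within each pair, so both pairs may be taken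
    sorted. *)
Lemma interleaveE (u : seq nat) p q x1 x2 y1 y2 :
  (forall j, j < size u -> nth 0 u j = p -> j = x1 \/ j = x2) ->
  (forall j, j < size u -> nth 0 u j = q -> j = y1 \/ j = y2) ->
  nth 0 u x1 = p -> nth 0 u x2 = p -> nth 0 u y1 = q -> nth 0 u y2 = q ->
  x1 <> x2 -> y1 <> y2 -> x1 < size u -> x2 < size u -> y1 < size u ->
  y2 < size u -> p != q ->
  subseq [:: p; q; p; q] u || subseq [:: q; p; q; p] u =
    ((x1 < y1) (+) (x2 < y1)) (+) ((x1 < y2) (+) (x2 < y2)).
Proof.
wlog lt_x : x1 x2 / x1 < x2 => [IH|].
  have [lt|lt|->] := ltngtP x1 x2; [exact: IH | | by []].
  move=> op oq px1 px2 qy1 qy2 nx ny lx1 lx2 ly1 ly2 npq.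
  rewrite (IH x2 x1) //; last by move=> h; apply: nx.
    by rewrite ![(x2 < _) (+) _]addbC.
  by move=> j lj /op-/(_ lj)[]; [right|left].
wlog lt_y : y1 y2 / y1 < y2 => [IH|].
  have [lt|lt|->] := ltngtP y1 y2; [exact: IH | | by []].
  move=> op oq px1 px2 qy1 qy2 nx ny lx1 lx2 ly1 ly2 npq.
  rewrite (IH y2 y1) //; first by rewrite addbC.
  by move=> j lj /oq-/(_ lj)[]; [right|left].
  by move=> h; apply: ny.
move=> op oq px1 px2 qy1 qy2 _ _ lx1 lx2 ly1 ly2 npq.
rewrite (@interleave_sorted u p q x1 x2 y1 y2) //.
rewrite (@interleave_sorted u q p y1 y2 x1 x2) //.
have n11 : x1 != y1 by apply: contra_neq npq => e; rewrite -px1 -qy1 e.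
have n12 : x1 != y2 by apply: contra_neq npq => e; rewrite -px1 -qy2 e.
have n21 : x2 != y1 by apply: contra_neq npq => e; rewrite -px2 -qy1 e.
have n22 : x2 != y2 by apply: contra_neq npq => e; rewrite -px2 -qy2 e.
clear - lt_x lt_y n11 n12 n21 n22.
case: (ltngtP x1 y1) n11 => // h11 _; case: (ltngtP x2 y1) n21 => // h21 _;
case: (ltngtP x1 y2) n12 => // h12 _; case: (ltngtP x2 y2) n22 => // h22 _ //=;
lia.
Qed.

Lemma occ_index (u : seq nat) p x1 x2 :
  (forall j, j < size u -> nth 0 u j = p -> j = x1 \/ j = x2) ->
  nth 0 u x1 = p -> nth 0 u x2 = p -> x1 < x2 -> x2 < size u ->
  occ1 p u = x1 /\ occ2 p u = x2.
Proof.
move=> occ px1 px2 lt_x lx2; have lx1 := ltn_trans lt_x lx2.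
have o1 : occ1 p u = x1.
  have pu : p \in u by rewrite -px1 mem_nth.
  have lo : occ1 p u < size u by rewrite index_mem.
  case: (occ _ lo (nth_index 0 pu)) => // e.
  suff : occ1 p u <= x1 by rewrite e leqNgt lt_x.
  by rewrite leqNgt; apply/negP => /(before_find 0) /=; rewrite px1 eqxx.
split=> //; rewrite /occ2 o1; set v := drop _ _.
have e2 : nth 0 v (x2 - x1.+1) = p by rewrite nth_drop subnKC.
have pv : p \in v by rewrite -e2 mem_nth // size_drop ltn_sub2r // (leq_ltn_trans lt_x).
have lv : x1.+1 + index p v < size u.
  by rewrite -ltn_subRL -[X in _ < X]size_drop index_mem.
have := nth_index 0 pv; rewrite {1}/v nth_drop => /(occ _ lv)[] // e.
by have := leq_addr (index p v) x1.+1; rewrite e ltnn.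
Qed.

Section PointerSlots.
Variables (n : nat) (w : seq nat).
Hypothesis w_perm : perm_eq w (iota 1 n).

Lemma size_word : size w = n.
Proof. by rewrite (perm_size w_perm) size_iota. Qed.

Lemma uniq_word : uniq w.
Proof. by rewrite (perm_uniq w_perm) iota_uniq. Qed.

Lemma mem_word x : (x \in w) = (0 < x <= n).
Proof. by rewrite (perm_mem w_perm) mem_iota add1n ltnS. Qed.

Lemma pointer_mem p : is_pointer n p -> p \in w /\ p.+1 \in w.
Proof. by case/andP=> p0 pn; rewrite !mem_word p0 ltnW. Qed.

Lemma index_lt x : x \in w -> index x w < n.
Proof. by rewrite -index_mem size_word. Qed.

Lemma index_neq x y : x \in w -> x != y -> index x w != index y w.
Proof.
move=> xw; apply: contra_neq => e; rewrite -[LHS](nth_index 0 xw) e nth_index //.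
by rewrite -index_mem -e index_mem.
Qed.

Definition rslot p := (index p w).*2.+1.
Definition lslot p := (index p.+1 w).*2.

Lemma slot_lt p : is_pointer n p ->
  rslot p < size (full_pointer_word w) /\ lslot p < size (full_pointer_word w).
Proof.
case/pointer_mem=> /index_lt l1 /index_lt l2; rewrite size_full size_word.
by rewrite /rslot /lslot ltn_Sdouble ltn_double.
Qed.

Lemma nth_slot p : is_pointer n p ->
  nth 0 (full_pointer_word w) (rslot p) = p /\
  nth 0 (full_pointer_word w) (lslot p) = p.
Proof.
move=> ptr; have [l1 l2] := slot_lt ptr; rewrite size_full in l1 l2.
have [pw p1w] := pointer_mem ptr.
rewrite !nth_full // /rslot /lslot /= !odd_double /= uphalf_double doubleK.
by rewrite !nth_index.
Qed.

Lemma slotP p j : is_pointer n p -> j < size (full_pointer_word w) ->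
  nth 0 (full_pointer_word w) j = p -> j = rslot p \/ j = lslot p.
Proof.
move=> /andP[p0 pn]; rewrite size_full => lt_j; rewrite nth_full //.
have lt_j2 : j./2 < size w by rewrite ltn_half_double.
have jw : nth 0 w j./2 \in w by rewrite mem_nth.
have := odd_double_half j; rewrite /rslot /lslot.
case: ifP => odd_j def_j e; [left | right].
  by rewrite -e index_uniq ?uniq_word.
rewrite -e prednK ?index_uniq ?uniq_word //.
by move: jw; rewrite mem_word => /andP[].
Qed.

Lemma slot_neq p q : rslot p <> lslot q.
Proof. by move/(congr1 odd); rewrite /= !odd_double. Qed.

(** The letters dropped from the full word are neither [p] nor [q], so interleaving can be tested on
    the slots of the full word. *)
Lemma compatible_crossing p q : is_pointer n p -> is_pointer n q -> p != q ->
  compatible w p q = crossing w p q.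
Proof.
move=> ptr_p ptr_q npq; rewrite /compatible npq /= /pointer_word.
rewrite !subseq_filter /= !size_word ptr_p ptr_q /=.
have [lp1 lp2] := slot_lt ptr_p; have [lq1 lq2] := slot_lt ptr_q.
have [np1 np2] := nth_slot ptr_p; have [nq1 nq2] := nth_slot ptr_q.
rewrite (@interleaveE _ p q (rslot p) (lslot p) (rslot q) (lslot q)) //;
  try exact: slot_neq; try by move=> j; apply: slotP.
rewrite /crossing /inside /rslot /lslot ltnS ltn_double ltn_Sdouble.
rewrite ltnS leq_double ltn_double.
(* [inside] compares these two indices weakly, the slots strictly; the entries are distinct, so both
   tests agree. *)
rewrite [index p.+1 w <= index q.+1 w]leq_eqVlt.
have [_ p1w] := pointer_mem ptr_p.
by have /negbTE-> : index p.+1 w != index q.+1 w by apply: index_neq.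
Qed.

Lemma compatible_crosses p q : compatible w p q -> crossing w p q.
Proof.
move=> cmp; have [ptr_p ptr_q] := compatible_pointer w_perm cmp.
by rewrite -compatible_crossing //; case/andP: cmp.
Qed.

Lemma occ_slot p : is_pointer n p ->
  occ1 p (full_pointer_word w) = minn (rslot p) (lslot p) /\
  occ2 p (full_pointer_word w) = maxn (rslot p) (lslot p).
Proof.
move=> ptr; have [l1 l2] := slot_lt ptr; have [n1 n2] := nth_slot ptr.
have := @slot_neq p p; case: (ltngtP (rslot p) (lslot p)) => // lt _.
  by apply: occ_index => // j; apply: slotP.
by apply: occ_index => // j lj e; apply/or_comm; apply: slotP.
Qed.

End PointerSlots.

(** * Block swaps as maps of indices, and the cuts made by a move *)

Definition swap_blocks (c1 c2 c3 c4 : nat) (w : seq nat) : seq nat :=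
  take c1 w ++ block c3 c4 w ++ block c2 c3 w ++ block c1 c2 w ++ drop c4 w.

(** The new index of the entry of old index [i], also defined (as the identity) beyond the end of
    the word. *)
Definition relocate (c1 c2 c3 c4 i : nat) : nat :=
  if i < c1 then i
  else if i < c2 then c1 + (c4 - c3) + (c3 - c2) + (i - c1)
  else if i < c3 then c1 + (c4 - c3) + (i - c2)
  else if i < c4 then c1 + (i - c3)
  else i.

(* The regions cut out by c1, .., c4 are coded by two bits, so that two entries
   change their relative order iff the symplectic form of their codes is 1. *)
Lemma relocate_lt c1 c2 c3 c4 i j (e := fun i => (c1 <= i) (+) (c3 <= i))
    (f := fun i => (c2 <= i) (+) (c4 <= i)) :
  c1 <= c2 -> c2 <= c3 -> c3 <= c4 ->
  (relocate c1 c2 c3 c4 i < relocate c1 c2 c3 c4 j) =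
    (i < j) (+) ((e i && f j) (+) (f i && e j)).
Proof.
move=> c12 c23 c34; rewrite /e /f /relocate {e f}.
case: (ltnP i c1) => i1; case: (ltnP i c2) => i2; try lia;
case: (ltnP i c3) => i3; try lia; case: (ltnP i c4) => i4; try lia;
case: (ltnP j c1) => j1; case: (ltnP j c2) => j2; try lia;
case: (ltnP j c3) => j3; try lia; case: (ltnP j c4) => j4; rewrite /=; lia.
Qed.

Section SwapBlocks.
Variables (w : seq nat) (c1 c2 c3 c4 : nat).
Hypotheses (c12 : c1 <= c2) (c23 : c2 <= c3) (c34 : c3 <= c4) (c4w : c4 <= size w).

Lemma size_block i j : j <= size w -> size (block i j w) = j - i.
Proof. by move=> le_j; rewrite size_drop size_takel. Qed.

Lemma nth_block i j k : k < j - i -> nth 0 (block i j w) k = nth 0 w (i + k).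
Proof. by move=> lt_k; rewrite nth_drop nth_take // -ltn_subRL. Qed.

Lemma relocate_ge i : c4 <= i -> relocate c1 c2 c3 c4 i = i.
Proof. clear - c12 c23 c34; rewrite /relocate => ?; do !case: ifP => ? //; lia. Qed.

Lemma nth_swap_blocks i : i < size w ->
  nth 0 (swap_blocks c1 c2 c3 c4 w) (relocate c1 c2 c3 c4 i) = nth 0 w i.
Proof.
move=> lt_i; have c3w := leq_trans c34 c4w; have c2w := leq_trans c23 c3w.
have c1w := leq_trans c12 c2w.
rewrite /swap_blocks !nth_cat !size_block // size_takel // /relocate.
case: (ltnP i c1) => [i1|i1]; first by rewrite i1 nth_take.
have step k l : (k + l < k) = false by rewrite ltnNge leq_addr.
case: (ltnP i c2) => [i2|i2].
  rewrite -!addnA step addKn step addKn step addKn ltn_sub2r ?(leq_ltn_trans i1) //.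
  by rewrite nth_block ?subnKC // ltn_sub2r // (leq_ltn_trans i1).
case: (ltnP i c3) => [i3|i3].
  rewrite -!addnA step addKn step addKn ltn_sub2r ?(leq_ltn_trans i2) //.
  by rewrite nth_block ?subnKC // ltn_sub2r // (leq_ltn_trans i2).
case: (ltnP i c4) => [i4|i4].
  rewrite step addKn ltn_sub2r ?(leq_ltn_trans i3) //.
  by rewrite nth_block ?subnKC // ltn_sub2r // (leq_ltn_trans i3).
have -> : (i < c1) = false by rewrite ltnNge i1.
have e : i = c1 + ((c4 - c3) + ((c3 - c2) + ((c2 - c1) + (i - c4)))).
  clear - c12 c23 c34 i4; lia.
rewrite {1 2 3 4 5 6 7}e addKn step addKn step addKn step addKn.
by rewrite nth_drop subnKC.
Qed.

Lemma perm_swap_blocks : perm_eq w (iota 1 (size w)) ->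
  perm_eq (swap_blocks c1 c2 c3 c4 w) w.
Proof. by move=> w_perm; apply: (perm_cuts w_perm). Qed.

Lemma index_swap_blocks x : perm_eq w (iota 1 (size w)) ->
  index x (swap_blocks c1 c2 c3 c4 w) = relocate c1 c2 c3 c4 (index x w).
Proof.
move=> w_perm; have p' := perm_swap_blocks w_perm.
have [xw|xw] := boolP (x \in w); last first.
  (* An absent entry has index [size w], which is fixed; this serves [n.+1], whose index stands for
     the right end of the word. *)
  by rewrite !memNindex ?(perm_mem p') // (perm_size p') relocate_ge.
have lx : index x w < size w by rewrite index_mem.
rewrite -{1}[x](nth_index 0 xw) -nth_swap_blocks // index_uniq //; last first.
  by rewrite (perm_uniq p') (uniq_word w_perm).
rewrite (perm_size p'); move: lx; move: (index x w) (size w) c4w => i s le_s lx.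
clear - c12 c23 c34 le_s lx; rewrite /relocate.
case: (ltnP i c1) => // i1; case: (ltnP i c2) => i2; first lia.
by case: (ltnP i c3) => i3; first lia; case: (ltnP i c4) => i4; lia.
Qed.

End SwapBlocks.

(* [a] and [b] are the positions of p and p+1, [a'] and [b'] those of q and
   q+1, and the four cases say whether the first occurrence of p, resp. of q,
   is to the right of p or to the left of p+1. *)
Definition cut_positions (a b a' b' c1 c2 c3 c4 : nat) : Prop :=
  [\/ [/\ a.+1 = c1, b = c3, a'.+1 = c2 & b' = c4] /\ [/\ c1 < c2, c2 <= c3 & c3 < c4],
      [/\ a.+1 = c1, b = c3, b' = c2 & a'.+1 = c4] /\ [/\ c1 <= c2, c2 < c3 & c3 < c4],
      [/\ b = c1, a.+1 = c3, a'.+1 = c2 & b' = c4] /\ [/\ c1 < c2, c2 < c3 & c3 <= c4]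
    | [/\ b = c1, a.+1 = c3, b' = c2 & a'.+1 = c4] /\ [/\ c1 < c2, c2 < c3 & c3 < c4]].

(** [uphalf] turns the slot of a right pointer into the index after its entry, and that of a left
    pointer into the index of its entry. By crossing, the pointer that occurs first also closes
    first. *)
Lemma cut_positionsP a b a' b' (r := a.*2.+1) (l := b.*2)
    (r' := a'.*2.+1) (l' := b'.*2) :
  a != a' -> b != b' ->
  ((a < a') (+) (b <= a')) (+) ((a < b') (+) (b <= b')) ->
  minn r l < minn r' l' ->
  cut_positions a b a' b' (uphalf (minn r l)) (uphalf (minn r' l'))
    (uphalf (maxn r l)) (uphalf (maxn r' l')) /\ maxn r l < maxn r' l'.
Proof.
rewrite /r /l /r' /l' {r l r' l'} => na nb.
have half k : uphalf k.*2.+1 = k.+1 by lia.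
have slot k k' : (k.*2.+1 < k'.*2) = (k < k') by lia.
have slot' k k' : (k.*2 < k'.*2.+1) = (k <= k') by lia.
have slots k k' : (k.*2 < k'.*2) = (k < k') by lia.
have slotr k k' : (k.*2.+1 < k'.*2.+1) = (k < k') by lia.
rewrite /minn /maxn !slot.
case: (ltnP a b) => ab; case: (ltnP a' b') => ab';
  rewrite ?half ?uphalf_double ?slot ?slot' ?slots ?slotr => cr lt;
  clear half slot slot' slots slotr.
- by split; [apply: Or41; split; split=> // | ]; lia.
- by split; [apply: Or42; split; split=> // | ]; lia.
- by split; [apply: Or43; split; split=> // | ]; lia.
- by split; [apply: Or44; split; split=> // | ]; lia.
Qed.

Section Moves.
Variables (n : nat) (w : seq nat).
Hypothesis w_perm : perm_eq w (iota 1 n).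

Lemma cds_swap_blocks p q : compatible w p q ->
  exists c1 c2 c3 c4, cds p q w = swap_blocks c1 c2 c3 c4 w /\
   (cut_positions (index p w) (index p.+1 w) (index q w) (index q.+1 w)
      c1 c2 c3 c4 \/
    cut_positions (index q w) (index q.+1 w) (index p w) (index p.+1 w)
      c1 c2 c3 c4).
Proof.
move=> cmp; have [ptr_p ptr_q] := compatible_pointer w_perm cmp.
have npq : p != q by case/andP: cmp.
have cr := compatible_crosses w_perm cmp.
have cr' : crossing w q p.
  apply: (compatible_crosses w_perm); move: cmp.
  by rewrite /compatible eq_sym orbC.
have [pw p1w] := pointer_mem w_perm ptr_p.
have [qw q1w] := pointer_mem w_perm ptr_q.
have na := index_neq pw npq; have nb := @index_neq w p.+1 q.+1 p1w npq.
have [op1 op2] := occ_slot w_perm ptr_p; have [oq1 oq2] := occ_slot w_perm ptr_q.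
rewrite /cds op1 op2 oq1 oq2.
set mp := minn (rslot w p) _; set mq := minn (rslot w q) _.
have [lt|lt|e] := ltngtP mp mq.
- have [cut lt'] := cut_positionsP na nb cr lt.
  do 4!eexists; split; last by left; apply: cut.
  by rewrite (minn_idPl (ltnW lt')) (maxn_idPr (ltnW lt')).
- rewrite eq_sym in na; rewrite eq_sym in nb.
  have [cut lt'] := cut_positionsP na nb cr' lt.
  do 4!eexists; split; last by right; apply: cut.
  by rewrite (minn_idPr (ltnW lt')) (maxn_idPl (ltnW lt')).
(* A tie is impossible: one letter would be both [p] and [q]. *)
have op : nth 0 (full_pointer_word w) mp = p.
  rewrite /mp; have [] := nth_slot w_perm ptr_p.
  by case: (ltnP (rslot w p)).
have oq : nth 0 (full_pointer_word w) mq = q.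
  rewrite /mq; have [] := nth_slot w_perm ptr_q.
  by case: (ltnP (rslot w q)).
by rewrite -op e oq eqxx in npq.
Qed.

End Moves.

Lemma cut_positions_sorted a b a' b' c1 c2 c3 c4 n :
  cut_positions a b a' b' c1 c2 c3 c4 ->
  a < n -> b < n -> a' < n -> b' < n ->
  [/\ c1 <= c2, c2 <= c3, c3 <= c4 & c4 <= n].
Proof. by case=> [] [[? ? ? ?] [? ? ?]] ? ? ? ?; subst; split=> //; apply: ltnW. Qed.

(** One pointer supplies the cuts [c1], [c3] and the other [c2], [c4], so the two bits coding the
    regions in [relocate_lt] are the [inside] bits of the two pointers. *)
Lemma cut_positions_between a b a' b' c1 c2 c3 c4 i :
  cut_positions a b a' b' c1 c2 c3 c4 ->
  (a < i) (+) (b <= i) = (c1 <= i) (+) (c3 <= i) /\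
  (a' < i) (+) (b' <= i) = (c2 <= i) (+) (c4 <= i).
Proof. by case=> [] [[<- <- <- <-]] _; split=> //; rewrite addbC. Qed.

Lemma cut_positions_adjacent a b a' b' c1 c2 c3 c4 :
  cut_positions a b a' b' c1 c2 c3 c4 ->
  relocate c1 c2 c3 c4 b = (relocate c1 c2 c3 c4 a).+1 /\
  relocate c1 c2 c3 c4 b' = (relocate c1 c2 c3 c4 a').+1.
Proof.
by rewrite /relocate; case=> [] [[? ? ? ?] [? ? ?]]; subst; split;
  do ![case: ltnP => ?]; lia.
Qed.

(** Gap [k] lies just left of index [k] and travels with the entry on its left; gap 0, preceded by
    the virtual entry 0, stays. *)
Definition relocate_gap c1 c2 c3 c4 k :=
  if k is k'.+1 then (relocate c1 c2 c3 c4 k').+1 else 0.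

(** Here [i] is the index of [x.+1], and the cycle map sends [x] to the entry left of gap [i]. If
    that is [p] ([i = a.+1]), its image lies left of gap [b], and if this is [q], the next image
    lies left of gap [b']. The entry so reached becomes the left neighbour of [x.+1]. *)
Lemma cut_positions_shortcut a b a' b' c1 c2 c3 c4 i :
  cut_positions a b a' b' c1 c2 c3 c4 -> i != b -> i != b' ->
  [/\ b != a.+1 /\ b' != a'.+1,
      i != a.+1 -> i != a'.+1 ->
        relocate_gap c1 c2 c3 c4 i = relocate c1 c2 c3 c4 i,
      i = a.+1 -> relocate_gap c1 c2 c3 c4 (if b == a'.+1 then b' else b) =
                  relocate c1 c2 c3 c4 i
    & i = a'.+1 -> relocate_gap c1 c2 c3 c4 (if b' == a.+1 then b else b') =
                  relocate c1 c2 c3 c4 i].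
Proof.
have gapE k : relocate_gap c1 c2 c3 c4 k =
    if k == 0 then 0 else (relocate c1 c2 c3 c4 k.-1).+1 by case: k.
rewrite !gapE => cut nb nb'; split.
- by case: cut => [] [[? ? ? ?] [? ? ?]]; lia.
- move=> n1 n2; case: eqP => [i0|i0]; rewrite /relocate;
  case: cut => [] [[? ? ? ?] [? ? ?]]; subst; clear gapE; do ![case: ltnP => ? //]; lia.
- move=> ei; case: (eqVneq b a'.+1) => eb;
  case: cut => [] [[? ? ? ?] [? ? ?]]; subst; clear gapE; case: eqP => ? //; try lia; rewrite /relocate; do ![case: ltnP => ? //]; lia.
- move=> ei; case: (eqVneq b' a.+1) => eb;
  case: cut => [] [[? ? ? ?] [? ? ?]]; subst; clear gapE; case: eqP => ? //; try lia; rewrite /relocate; do ![case: ltnP => ? //]; lia.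
Qed.

(** * The cycle permutation and the bypassing of points *)

Lemma next_iota0 n x : x <= n -> next (iota 0 n.+1) x = if x < n then x.+1 else 0.
Proof.
move=> le_x; rewrite next_nth mem_iota add0n ltnS le_x.
change (nth 0 (iota 1 n) (index x (iota 0 n.+1)) = if x < n then x.+1 else 0).
have -> : index x (iota 0 n.+1) = x.
  rewrite -{1}[x](@nth_iota 0 0 n.+1 x) ?ltnS // index_uniq ?iota_uniq //.
  by rewrite size_iota.
by case: ltnP => h; [rewrite nth_iota | rewrite nth_default ?size_iota].
Qed.

(** [a] marks the points to skip. Applying [d] twice suffices, since an unmarked point is followed
    by at most two marked ones in a row. *)
Lemma path_shortcut (f f' : nat -> nat) (a ok : pred nat)
    (d := fun y => if a y then f y else y) :
  (forall x, ok x -> ok (f x)) ->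
  (forall x, ok x -> ~~ a x -> ~~ a (d (d (f x))) /\ f' x = d (d (f x))) ->
  ~~ a 0 ->
  forall s x, ok x -> ~~ a x -> fpath f x (rcons s 0) ->
    fpath f' x (rcons [seq y <- s | ~~ a y] 0).
Proof.
(* One step of [f'] can consume three steps of [f], hence induction on a bound for the size. *)
move=> okf short a0 s; have [k] := ubnP (size s).
elim: k s => // k IHk s lt_s x okx ax.
have d0 y : ~~ a y -> d y = y by rewrite /d => /negbTE->.
have d1 y : a y -> d y = f y by rewrite /d => ->.
have [asx eqx] := short x okx ax; have okfx := okf _ okx.
case: s lt_s => [_ /=|y s lt_s /= /andP[/eqP fxy]].
  by rewrite !andbT => /eqP fx0; rewrite eqx fx0 !d0.
rewrite fxy in eqx asx okfx *.
have [ay | ay] /= := boolP (a y); last first.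
  by rewrite eqx !d0 // eqxx /=; apply: IHk.
rewrite (d1 _ ay) in eqx asx; have okfy := okf _ okfx.
case: s lt_s => [_ /=|z s lt_s /= /andP[/eqP fyz]].
  by rewrite !andbT => /eqP fy0; rewrite eqx fy0 !d0.
rewrite fyz in eqx asx okfy *.
have [az | az] /= := boolP (a z); last first.
  by rewrite eqx d0 // eqxx /=; apply: IHk; rewrite // -ltnS ltnW.
rewrite (d1 _ az) in eqx asx; have okfz := okf _ okfy.
case: s lt_s => [_ /=|t s lt_s /= /andP[/eqP fzt]].
  by rewrite !andbT => /eqP fz0; rewrite eqx fz0.
rewrite fzt in eqx asx okfz *.
by rewrite asx /= eqx eqxx /=; apply: IHk; rewrite // -ltnS ltnW // ltnW.
Qed.

Definition bypass (f : nat -> nat) p q y := if (y == p) || (y == q) then f y else y.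

Lemma bypassC f p q y : bypass f p q y = bypass f q p y.
Proof. by rewrite /bypass orbC. Qed.

Section CycleGraph.
Variables (n : nat) (w : seq nat).
Hypothesis w_perm : perm_eq w (iota 1 n).

Let before i := nth 0 (0 :: w) i.

(** [Yperm] steps to the left neighbour in [0 :: w], cyclically. The case [x = n] fits the formula
    because the absent [n.+1] has index [n], and the gap there follows the last entry. *)
Lemma Cperm_gap x : x <= n -> Cperm w x = before (index x.+1 w).
Proof.
move=> le_x; have w0 : 0 \notin w by rewrite (mem_word w_perm).
have u0w : uniq (0 :: w) by rewrite /= w0 (uniq_word w_perm).
rewrite /Cperm /= /Yperm -rev_cons next_rev // prev_nth (size_word w_perm).
rewrite /Xperm next_iota0 //; case: ltnP => [lt_x|ge_x].
  by rewrite inE (mem_word w_perm) lt_x.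
rewrite mem_head !memNindex // (mem_word w_perm) ltnS andTb -ltnNge //.
Qed.

Lemma Cperm_le x : x <= n -> Cperm w x <= n.
Proof.
move=> le_x; rewrite Cperm_gap // /before.
case: (index _ _) => //= i; have [lt_i | ge_i] := ltnP i (size w).
  by have := mem_nth 0 lt_i; rewrite (mem_word w_perm) => /andP[].
by rewrite nth_default.
Qed.

Lemma before_eq p i : p \in w -> i <= n -> (before i == p) = (i == (index p w).+1).
Proof.
move=> pw; have p0 : 0 < p by move: pw; rewrite (mem_word w_perm) => /andP[].
case: i => [|i] le_i; first by rewrite /before /= eq_sym gtn_eqF.
rewrite /before /= eqSS; apply/eqP/eqP => [<-|->]; last exact: nth_index.
by rewrite index_uniq ?(uniq_word w_perm) ?(size_word w_perm).
Qed.

End CycleGraph.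

(** * Effect of a move on cycles and crossings *)

Section Moves.
Variables (n : nat) (w : seq nat).
Hypothesis w_perm : perm_eq w (iota 1 n).

Let w_perm' : perm_eq w (iota 1 (size w)).
Proof. by rewrite (size_word w_perm). Qed.

(** [cut_positions_shortcut] read on entries; [d] occurs twice because [p] and [q] may be met one
    after the other. *)
Lemma Cperm_swap_blocks p q c1 c2 c3 c4 x (d := bypass (Cperm w) p q) :
  is_pointer n p -> is_pointer n q -> p != q ->
  cut_positions (index p w) (index p.+1 w) (index q w) (index q.+1 w) c1 c2 c3 c4 ->
  x <= n -> x != p -> x != q ->
  let y := d (d (Cperm w x)) in
  ~~ ((y == p) || (y == q)) /\ Cperm (swap_blocks c1 c2 c3 c4 w) x = y.
Proof.
move=> ptr_p ptr_q npq cut le_x xp xq.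
have [pw p1w] := pointer_mem w_perm ptr_p.
have [qw q1w] := pointer_mem w_perm ptr_q.
have [c12 c23 c34 c4n] := cut_positions_sorted cut (index_lt w_perm pw)
  (index_lt w_perm p1w) (index_lt w_perm qw) (index_lt w_perm q1w).
have c4w : c4 <= size w by rewrite (size_word w_perm).
have p' := perm_swap_blocks c12 c23 c34 c4w w_perm'.
have w'_perm := perm_trans p' w_perm.
set w' := swap_blocks c1 c2 c3 c4 w in p' w'_perm *.
have ple : p <= n by case/andP: ptr_p => _ /ltnW.
have qle : q <= n by case/andP: ptr_q => _ /ltnW.
have ile y : index y w <= n by rewrite -(size_word w_perm) index_size.
have nb : index x.+1 w != index p.+1 w by rewrite eq_sym index_neq // eq_sym.
have nb' : index x.+1 w != index q.+1 w by rewrite eq_sym index_neq // eq_sym.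
have gapE k : k <= n ->
    nth 0 (0 :: w') (relocate_gap c1 c2 c3 c4 k) = nth 0 (0 :: w) k.
  case: k => // k lt_k; apply: nth_swap_blocks; rewrite ?(size_word w_perm) //.
rewrite (Cperm_gap w'_perm le_x) (index_swap_blocks c12 c23 c34 c4w _ w_perm').
rewrite (Cperm_gap w_perm le_x) /=.
have [[na na'] s0 s1 s2] := cut_positions_shortcut cut nb nb'.
have bE := before_eq w_perm; have gap := Cperm_gap w_perm.
move: (ile x.+1) nb nb' s0 s1 s2; move: (index x.+1 w) => i le_i nb nb' s0 s1 s2.
(* On gaps, bypassing [p] jumps from the gap after [p] to the gap before [p.+1]. *)
have dE k : k <= n -> d (nth 0 (0 :: w) k) = nth 0 (0 :: w)
    (if k == (index p w).+1 then index p.+1 w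
     else if k == (index q w).+1 then index q.+1 w else k).
  move=> le_k; rewrite /d /bypass !bE //.
  case: eqP => [->|_] /=; first by rewrite nth_index // gap.
  by case: eqP => [->|_] //=; rewrite nth_index // gap.
have npq' : ((index q w).+1 == (index p w).+1) = false.
  by rewrite eqSS eq_sym (negbTE (index_neq pw npq)).
have [ei|ni] := eqVneq i (index p w).+1.
  rewrite dE // ei eqxx dE // (negbTE na) -ei -(s1 ei); case: ifP => e.
    rewrite !bE // gapE // (negbTE na') orbF; split=> //.
    by rewrite -ei eq_sym.
  by rewrite !bE // gapE // (negbTE na) e.
have [ei'|ni'] := eqVneq i (index q w).+1.
  rewrite dE // ei' npq' eqxx dE // (negbTE na') -ei' -(s2 ei').
  case: ifP => e.
    by rewrite !bE // gapE // (negbTE na) /= -ei' eq_sym.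
  by rewrite !bE // gapE // (negbTE na') e.
rewrite !dE // (negbTE ni) (negbTE ni') // (negbTE ni) (negbTE ni').
by rewrite !bE // (negbTE ni) (negbTE ni') -s0 // gapE.
Qed.

Lemma Cperm_cds p q x (d := bypass (Cperm w) p q) :
  compatible w p q -> x <= n -> x != p -> x != q ->
  let y := d (d (Cperm w x)) in
  ~~ ((y == p) || (y == q)) /\ Cperm (cds p q w) x = y.
Proof.
move=> cmp le_x xp xq; have [ptr_p ptr_q] := compatible_pointer w_perm cmp.
have npq : p != q by case/andP: cmp.
have [c1 [c2 [c3 [c4 [-> [cut|cut]]]]]] := cds_swap_blocks w_perm cmp.
  exact: Cperm_swap_blocks.
rewrite eq_sym in npq; have := Cperm_swap_blocks ptr_q ptr_p npq cut le_x xq xp.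
by rewrite /= !(bypassC _ q p) orbC.
Qed.

(** The order of two entries changes by the symplectic form of their [inside] bits. Summed over the
    four pairs from [r], [r.+1] and [s], [s.+1], bilinearity turns these bits into crossings with
    [p] and [q]. *)
Lemma crossing_swap_blocks p q c1 c2 c3 c4 r s :
  is_pointer n p -> is_pointer n q ->
  cut_positions (index p w) (index p.+1 w) (index q w) (index q.+1 w) c1 c2 c3 c4 ->
  crossing (swap_blocks c1 c2 c3 c4 w) r s =
    crossing w r s (+) ((crossing w p r && crossing w q s) (+)
                        (crossing w q r && crossing w p s)).
Proof.
move=> ptr_p ptr_q cut.
have [pw p1w] := pointer_mem w_perm ptr_p.
have [qw q1w] := pointer_mem w_perm ptr_q.
have [c12 c23 c34 c4n] := cut_positions_sorted cut (index_lt w_perm pw)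
  (index_lt w_perm p1w) (index_lt w_perm qw) (index_lt w_perm q1w).
have c4w : c4 <= size w by rewrite (size_word w_perm).
have inE1 i := (cut_positions_between i cut).1.
have inE2 i := (cut_positions_between i cut).2.
rewrite /crossing /inside !inE1 !inE2 !(index_swap_blocks c12 c23 c34 c4w _ w_perm').
rewrite ![relocate _ _ _ _ _ <= relocate _ _ _ _ _]leqNgt !relocate_lt //.
rewrite ![index _ w <= index _ w]leqNgt.
do !move: (index _ w < index _ w) => ?.
do !move: ((c1 <= index _ w) (+) (c3 <= index _ w)) => ?.
do !move: ((c2 <= index _ w) (+) (c4 <= index _ w)) => ?.
by clear; do !match goal with b : bool |- _ => case: b end.
Qed.

Lemma crossing_cds p q r s : compatible w p q ->
  crossing (cds p q w) r s =
    crossing w r s (+) ((crossing w p r && crossing w q s) (+)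
                        (crossing w q r && crossing w p s)).
Proof.
move=> cmp; have [ptr_p ptr_q] := compatible_pointer w_perm cmp.
have [c1 [c2 [c3 [c4 [-> [cut|cut]]]]]] := cds_swap_blocks w_perm cmp.
  exact: crossing_swap_blocks cut.
by rewrite (crossing_swap_blocks _ _ ptr_q ptr_p cut); congr (_ (+) _); rewrite addbC.
Qed.

Lemma index_cds p q : compatible w p q ->
  index p.+1 (cds p q w) = (index p (cds p q w)).+1 /\
  index q.+1 (cds p q w) = (index q (cds p q w)).+1.
Proof.
move=> cmp; have [ptr_p ptr_q] := compatible_pointer w_perm cmp.
have [/(index_lt w_perm) pw /(index_lt w_perm) p1w] := pointer_mem w_perm ptr_p.
have [/(index_lt w_perm) qw /(index_lt w_perm) q1w] := pointer_mem w_perm ptr_q.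
have [c1 [c2 [c3 [c4 [-> cut]]]]] := cds_swap_blocks w_perm cmp.
have [c12 c23 c34] : [/\ c1 <= c2, c2 <= c3, c3 <= c4 & c4 <= n].
  by case: cut => /cut_positions_sorted; apply.
rewrite -(size_word w_perm) => c4w; rewrite !index_swap_blocks //.
by case: cut => /cut_positions_adjacent[].
Qed.

(** An adjacency leaves no entry between the two occurrences of its pointer, so [inside] is
    constantly false. *)
Lemma crossing_cds_self p q r : compatible w p q ->
  crossing (cds p q w) p r = false /\ crossing (cds p q w) q r = false.
Proof.
by case/index_cds=> ep eq; rewrite /crossing /inside ep eq !addbb.
Qed.
End Moves.

(** * The strategic pile as a path from [n] to 0 *)

Lemma mem_SP w x : (x \in SP w) = (x \in pile w).
Proof. by rewrite /SP inE /=. Qed.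

(** A nonempty pile certifies that 0 occurs in [pile_cycle], and its first occurrence ends the path.
    The size bound comes from the length of that trajectory. *)
Lemma pileP w : pile w != [::] ->
  [/\ fpath (Cperm w) (size w) (rcons (pile w) 0), 0 \notin pile w
    & size (pile w) < size w].
Proof.
rewrite /pile /pile_cycle trajectS; set c := _ :: _.
case: ifP => // c0; have lt_k : index 0 c < size c by rewrite index_mem.
have : index 0 c = index 0 c by [].
case: {2}(index 0 c) => [|k] def_k; rewrite def_k //= => _.
rewrite def_k /= size_traject ltnS in lt_k.
have take_k := take_traject (Cperm w) (Cperm w (size w)) (ltnW lt_k).
have pathE : rcons (take k (traject (Cperm w) (Cperm w (size w)) (size w))) 0 =
    traject (Cperm w) (Cperm w (size w)) k.+1.
  rewrite trajectSr take_k; congr rcons.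
  have := nth_index 0 c0; rewrite def_k /c /= => <-.
  by rewrite (set_nth_default (Cperm w (size w))) ?size_traject // nth_traject.
split; first by rewrite pathE fpath_traject.
  apply/negP => /(index_ltn); rewrite ltnNge => /negP; apply.
  move: def_k; rewrite /c /=; case: eqP => // _ [->] //.
by rewrite size_takel ?size_traject // ltnW.
Qed.

(** Converse of [pileP]: an orbit is determined by its start, and the size bound puts the first 0
    within the trajectory searched by [pile]. *)
Lemma pile_path w s : fpath (Cperm w) (size w) (rcons s 0) -> 0 \notin s ->
  size s < size w -> pile w = s.
Proof.
move=> /fpathE; rewrite size_rcons => def_s s0 lt_s.
have c0 : size w == 0 = false by case: (size w) lt_s.
have [t def_t] : exists t,
    traject (Cperm w) (Cperm w (size w)) (size w) = s ++ 0 :: t.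
  eexists; rewrite -cat_rcons def_s.
  by rewrite -[X in traject _ _ X = _](subnKC lt_s) trajectD.
rewrite /pile /pile_cycle trajectS def_t.
rewrite inE mem_cat mem_head !orbT /= c0 index_cat (negbTE s0) /= addn0.
by rewrite take_size_cat.
Qed.

(** * Excellence under a move *)

Section Excellent.
Variables (n : nat) (w : seq nat).
Hypothesis w_perm : perm_eq w (iota 1 n).

(** A nonempty pile gives a path from [n] to 0, from which bypassing deletes [p] and [q]; the ends
    survive, as neither is a pointer. *)
Lemma SP_cds p q : SP w != fset0 -> compatible w p q ->
  SP (cds p q w) = (SP w `\` [fset p; q])%fset.
Proof.
move=> SP0 cmp; have [ptr_p ptr_q] := compatible_pointer w_perm cmp.
have [w'_perm _ _] := cds_spec w_perm cmp.
have pile0 : pile w != [::].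
  apply: contra_neq SP0 => e; apply/fsetP => x.
  by rewrite mem_SP e in_fset0.
have [path_w s0 lt_s] := pileP pile0.
pose a := [pred y | (y == p) || (y == q)].
have : pile (cds p q w) = [seq y <- pile w | ~~ a y].
  apply: pile_path.
  - rewrite (size_word w'_perm); rewrite (size_word w_perm) in path_w.
    have [/andP[p0 pn] /andP[q0 qn]] := (ptr_p, ptr_q).
    apply: (@path_shortcut (Cperm w) _ a (fun x => x <= n)) path_w => //=.
    + exact: Cperm_le.
    + move=> x le_x; rewrite negb_or => /andP[xp xq].
      exact: (Cperm_cds w_perm cmp).
    + by rewrite !ltn_eqF.
    + by rewrite !gtn_eqF.
  - by rewrite mem_filter (negbTE s0) andbF.
  rewrite (size_word w'_perm) -(size_word w_perm).
  by apply: leq_ltn_trans lt_s; rewrite size_filter count_size.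
move=> e; apply/fsetP => x.
by rewrite mem_SP e mem_filter in_fsetD mem_SP !inE.
Qed.

Lemma compatibleC p q : compatible w p q = compatible w q p.
Proof. by rewrite /compatible eq_sym orbC. Qed.

(** For two other pointers of [P] both products in the pivot formula are true and cancel; for a
    pointer outside [P] both vanish. So only the crossings with [p] and [q] are lost. *)
Lemma excellent_cds (P : {fset nat}) p q :
  (forall r, r \in P -> is_pointer n r) -> excellent P w ->
  p \in P -> q \in P -> p != q ->
  excellent (P `\` [fset p; q])%fset (cds p q w).
Proof.
move=> ptrP [cmpP isoP SPw] pP qP npq; have cmp := cmpP _ _ pP qP npq.
have [w'_perm _ _] := cds_spec w_perm cmp.
rewrite (size_word w_perm) in isoP.
have crP r s : r \in P -> s \in P -> r != s -> crossing w r s.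
  by move=> rP sP nrs; apply: (compatible_crosses w_perm); apply: cmpP.
have memD r : (r \in (P `\` [fset p; q])%fset) = [&& r != p, r != q & r \in P].
  by rewrite in_fsetD !inE negb_or andbA.
split.
- move=> r s; rewrite !memD => /and3P[rp rq rP] /and3P[sp sq sP] nrs.
  rewrite (compatible_crossing w'_perm) ?ptrP // (crossing_cds w_perm) //.
  by rewrite !crP // eq_sym.
- rewrite (size_word w'_perm) => r s ptr_r ptr_s; rewrite memD => rP.
  have [<-|nrs] := eqVneq r s; first by rewrite /compatible eqxx.
  rewrite (compatible_crossing w'_perm) //.
  have [->|rp] := eqVneq r p; first by rewrite (crossing_cds_self w_perm _ cmp).1.
  have [->|rq] := eqVneq r q; first by rewrite (crossing_cds_self w_perm _ cmp).2.
  rewrite rp rq /= in rP; rewrite (crossing_cds w_perm) //.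
  have cr_r t : t \in P -> r != t -> crossing w t r = false.
    rewrite eq_sym => tP ntr; have ptr_t := ptrP _ tP.
    rewrite -(compatible_crossing w_perm) // compatibleC.
    by apply/negbTE/isoP.
  rewrite !cr_r // -(compatible_crossing w_perm) //.
  by rewrite (negbTE (isoP _ _ ptr_r ptr_s rP)).
rewrite SP_cds ?SPw //; apply/eqP => P0.
by move: pP; rewrite P0 in_fset0.
Qed.

End Excellent.

(** * Permutations without crossing chords *)

Lemma stable_values n (S : pred nat) x :
  (forall v, is_pointer n v -> S v = S v.+1) ->
  0 < x <= n -> S x -> forall y, 0 < y <= n -> S y.
Proof.
move=> stab; suff S1 y : 0 < y <= n -> S y = S 1.
  by move=> /S1-> S1' y /S1->.
elim: y => // [] [|y] // IHy /andP[_ lt_y].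
by rewrite -stab ?IHy //= /is_pointer /= ?lt_y // ltnW.
Qed.

Section FixedPoints.
Variables (n : nat) (w : seq nat).
Hypothesis w_perm : perm_eq w (iota 1 n).
Hypothesis w_fixed : forall p q, ~~ compatible w p q.

Lemma fixed_inside r v : is_pointer n r -> is_pointer n v -> r != v ->
  inside w r (index v w) = inside w r (index v.+1 w).
Proof.
move=> ptr_r ptr_v nrv; have := w_fixed r v.
by rewrite (compatible_crossing w_perm) // /crossing; do 2!case: (inside w r _).
Qed.

(* The entries strictly between the two occurrences of r are closed under value
   neighbours if r comes before r+1; otherwise the entries outside are. *)
Lemma fixed_pointer r : is_pointer n r ->
  index r.+1 w = (index r w).+1 \/ (index r.+1 w = 0 /\ (index r w).+1 = n).
Proof.
move=> ptr_r; have [rw r1w] := pointer_mem w_perm ptr_r.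
have [lt_r lt_r1] := (index_lt w_perm rw, index_lt w_perm r1w).
have vr : 0 < r <= n by rewrite -(mem_word w_perm).
have nthi i : i < n -> 0 < nth 0 w i <= n /\ index (nth 0 w i) w = i.
  move=> lt_i; rewrite -(mem_word w_perm) mem_nth ?(size_word w_perm) //.
  by rewrite index_uniq ?(size_word w_perm) ?(uniq_word w_perm).
have in_r b : b = inside w r (index r w) -> b = inside w r (index r.+1 w) ->
    forall i, i < n -> inside w r i = b.
  move=> e1 e2 i /nthi[vi <-].
  have stab v : is_pointer n v -> (inside w r (index v w) == b) =
      (inside w r (index v.+1 w) == b).
    move=> ptr_v; have [<-|nrv] := eqVneq r v; first by rewrite -e1 -e2.
    by rewrite (fixed_inside ptr_r).
  apply/eqP; apply: (stable_values (S := fun v => inside w r (index v w) == b)) vi.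
  - exact: stab.
  - exact: vr.
  - by rewrite -e1.
have n0 : 0 < n := leq_ltn_trans (leq0n _) lt_r.
have [lt|ge] := ltnP (index r w) (index r.+1 w); [left|right].
  apply/eqP; rewrite eqn_leq lt andbT leqNgt; apply/negP => gt.
  have := in_r false _ _ _ (ltn_trans gt lt_r1).
  rewrite /inside ltnn (leqNgt _ (index r w)) lt leqnn ltnSn (leqNgt _ _.+1) gt.
  by move=> /(_ erefl erefl).
have in_true i : i < n -> inside w r i.
  by apply: in_r; rewrite /inside ?ltnn ?leqnn ?ge // ltnNge ge.
split; first by have := in_true 0 n0; rewrite /inside ltn0 /= leqn0 => /eqP.
have n1 : n.-1 < n by rewrite ltn_predL.
have le_r1 : index r.+1 w <= n.-1 by rewrite -ltnS prednK.
have := in_true _ n1; rewrite /inside le_r1 addbT ltn_predRL.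
by move=> h; apply/eqP; rewrite eqn_leq lt_r leqNgt.
Qed.

(** As [p] is last, the second alternative of [fixed_pointer] is left to [p] alone and puts [p.+1]
    first; every other [r] is directly followed by [r.+1]. The word is then read off from both
    ends. *)
Lemma fixed_sigma p : is_pointer n p -> (index p w).+1 = n -> w = sigma n p.
Proof.
move=> ptr_p pn; have [p0 lt_pn] := andP ptr_p.
have p1 : index p.+1 w = 0.
  case: (fixed_pointer ptr_p) => [e|[//]].
  have [_ /(index_lt w_perm)] := pointer_mem w_perm ptr_p.
  by rewrite e pn ltnn.
have adj r : is_pointer n r -> r != p -> index r.+1 w = (index r w).+1.
  move=> ptr_r nrp; case: (fixed_pointer ptr_r) => // -[_ rn].
  have [rw _] := pointer_mem w_perm ptr_r.
  by have := index_neq rw nrp; rewrite -eqSS rn pn eqxx.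
have up i : i < n - p -> index (p.+1 + i) w = i.
  elim: i => [|i IHi] lt_i; first by rewrite addn0.
  rewrite addnS adj ?IHi ?(ltnW lt_i) //; last by rewrite neq_ltn ltnS leq_addr orbT.
  by rewrite /is_pointer /= addSnnS -ltn_subRL.
have down i : i < p -> index (p - i) w = n.-1 - i.
  elim: i => [|i IHi] lt_i; first by rewrite !subn0 -pn.
  have e : (p - i.+1).+1 = p - i by rewrite subnSK ?(ltnW lt_i).
  have := adj (p - i.+1); rewrite e IHi ?(ltnW lt_i) // => h.
  have {h} : n.-1 - i = (index (p - i.+1) w).+1.
    apply: h; first rewrite /is_pointer subn_gt0 lt_i /=.
      by apply: leq_ltn_trans lt_pn; rewrite leq_subr.
    by rewrite neq_ltn ltn_subrL p0.
  by move=> /(congr1 predn) /= <-; rewrite subnS.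
have size_s : size (sigma n p) = n.
  by rewrite size_cat !size_iota subnK // ltnW.
apply: (@eq_from_nth _ 0); rewrite (size_word w_perm) // => i lt_i.
have key x : 0 < x <= n -> index x w = i -> nth 0 w i = x.
  by rewrite -(mem_word w_perm) => xw <-; rewrite nth_index.
rewrite /sigma nth_cat size_iota; case: ltnP => lt_ip.
  by rewrite nth_iota //; apply: key; [rewrite /= addSn -ltn_subRL | apply: up].
(* The second block is indexed from the right end, as in [down]. *)
pose k := n.-1 - i; have [lt_k eq_k eq_i] : [/\ k < p, 1 + (i - (n - p)) = p - k
    & n.-1 - k = i].
  by clear - lt_pn lt_i lt_ip; rewrite /k; split; lia.
rewrite nth_iota; last by clear - lt_pn lt_i lt_ip; lia.
rewrite eq_k; apply: key; last by rewrite down.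
by rewrite subn_gt0 lt_k; apply: leq_trans (leq_subr _ _) (ltnW lt_pn).
Qed.
End FixedPoints.

(** * The values $g_{2m}(a)$ and their mex recursion *)

Definition grundy (m a : nat) : nat :=
  if (a + 2 <= m) || (a + 1 == m) && odd m then 0
  else if (m + 1 <= a) || (a == m) && odd m then 1
  else 2.

Lemma mex_eq s v : v \notin s -> (forall j, j < v -> j \in s) -> mex s = v.
Proof.
move=> vs lt_v; have [ms lt_m] := mexP s; have [lt|lt|//] := ltngtP (mex s) v.
  by rewrite (lt_v _ lt) in ms.
by rewrite (lt_m _ lt) in vs.
Qed.

(* A move picks two pointers of P, and k of them lie in the complement of A. *)
Definition reachable (a b c : nat) : Prop :=
  exists k, [/\ k <= 2, 2 - k <= a, k <= b & c = b - k].

(** The mex conditions for a parent with $2m+1$ pointers and children with $2m-1$: the value of the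
    parent is avoided, and 0 and 1 are attained when smaller. *)
Lemma grundy_step m a b : 0 < m -> a + b = m.*2.+1 ->
  [/\ forall c, reachable a b c -> grundy m c <> grundy m.+1 a,
      0 < grundy m.+1 a -> exists2 c, reachable a b c & grundy m c = 0
    & 1 < grundy m.+1 a -> exists2 c, reachable a b c & grundy m c = 1].
Proof.
move=> m0 ab; split.
- move=> c [k [k2 ka kb def_c]].
  rewrite /grundy; do ![case: ifP => ?]; lia.
- move=> g0; have [b0|b0] := posnP b.
    exists 0; first by exists 0; split; lia.
    by rewrite /grundy; case: ifP => //; lia.
  have [le|gt] := leqP (b + 1) m.
    exists b.-1; first by exists 1; split; lia.
    by rewrite /grundy; case: ifP => //; lia.
  (* The witness is the largest [c] with [grundy m c = 0]; positivity of [grundy m.+1 a] puts it at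
     most 2 below [b]. *)
  have [o|e] := boolP (odd m).
    exists m.-1; last by rewrite /grundy; case: ifP => //; lia.
    by exists (b - m.-1); move: g0; rewrite /grundy; do ![case: ifP => ?]; split; lia.
  exists m.-2; last by rewrite /grundy; case: ifP => //; lia.
  by exists (b - m.-2); move: g0; rewrite /grundy; do ![case: ifP => ?]; split; lia.
(* The value 2 forces [m] odd and [a] to be [m] or [m.+1], so [b - m] is 1 or 0. *)
- move=> g1; exists m; last first.
    by move: g1; rewrite /grundy; do ![case: ifP => ?]; lia.
  by exists (b - m); move: g1; rewrite /grundy; do ![case: ifP => ?]; split; lia.
Qed.

(** * Realizing counts by pairs of pointers, and the main induction *)

Section PointerPairs.
Local Open Scope fset_scope.
Local Open Scope nat_scope.
Implicit Types A B P S : {fset nat}.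

Lemma card_fsetD2 S p q : p != q ->
  #|` S| = (p \in S) + (q \in S) + #|` S `\` [fset p; q]|.
Proof.
move=> npq; rewrite (cardfsD1 p) (cardfsD1 q (S `\ p)) in_fsetD1 eq_sym npq /=.
by rewrite fsetDDl addnA.
Qed.

Lemma card_gt0_mem S : 0 < #|` S| -> exists p, p \in S.
Proof. by rewrite lt0n cardfs_eq0 => /fset0Pn. Qed.

Lemma card_gt1_mem S : 1 < #|` S| -> exists p q, [/\ p \in S, q \in S & p != q].
Proof.
move=> S2; have [p pS] := card_gt0_mem (ltnW S2).
have /card_gt0_mem[q] : 0 < #|` S `\ p| by move: S2; rewrite (cardfsD1 p) pS.
by rewrite in_fsetD1 => /andP[nqp qS]; exists p, q; rewrite eq_sym.
Qed.

Lemma reachable_pair P A p q : A `<=` P -> p \in P -> q \in P -> p != q ->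
  reachable #|` A| #|` P `\` A| #|` (P `\` A) `\` [fset p; q]|.
Proof.
move=> AP pP qP npq; have := card_fsetD2 A npq.
have := card_fsetD2 (P `\` A) npq; rewrite !in_fsetD pP qP !andbT => -> ->.
exists ((p \notin A) + (q \notin A)).
by split; rewrite ?leq_addr ?addKn //; do 2!case: (_ \in A).
Qed.

(** Take [k] pointers from the complement of [A] and [2 - k] from [A]; the bounds in [reachable]
    supply them. *)
Lemma reachable_pairP P A c : A `<=` P -> reachable #|` A| #|` P `\` A| c ->
  exists p q, [/\ p \in P, q \in P, p != q & c = #|` (P `\` A) `\` [fset p; q]|].
Proof.
move=> /fsubsetP AP [k [k2 ka kb ->]].
have [p [q [pP qP npq eq_k]]] : exists p q, [/\ p \in P, q \in P, p != q
    & k = (p \in P `\` A) + (q \in P `\` A)].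
  case: k k2 ka kb => [|[|[|//]]] _ ka kb.
  - have [p [q [pA qA npq]]] := card_gt1_mem ka; exists p, q.
    by split; rewrite ?AP // !in_fsetD pA qA.
  - have [p pA] := card_gt0_mem ka; have [q qB] := card_gt0_mem kb.
    exists p, q; move: (qB); rewrite !in_fsetD => /andP[qA qP].
    split=> //; first exact: AP; first by apply: contraNneq qA => <-.
    by rewrite pA qA qP.
  - have [p [q [pB qB npq]]] := card_gt1_mem kb; exists p, q.
    by rewrite pB qB; move: pB qB; rewrite !in_fsetD => /andP[_ ->] /andP[_ ->].
exists p, q; split=> //.
by rewrite (card_fsetD2 (P `\` A) npq) -eq_k addKn.
Qed.

Lemma excellent_compatible n w P r s : perm_eq w (iota 1 n) -> excellent P w ->
  compatible w r s -> [/\ r \in P, s \in P & r != s].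
Proof.
move=> w_perm [_ isoP _] cmp.
have [ptr_r ptr_s] := compatible_pointer w_perm cmp.
have [nrs _] := andP cmp; rewrite (size_word w_perm) in isoP.
split=> //; [have := isoP _ _ ptr_r ptr_s | have := isoP _ _ ptr_s ptr_r].
  by case: (_ \in P) => //; rewrite cmp => /(_ isT).
by rewrite compatibleC; case: (_ \in P) => //; rewrite cmp => /(_ isT).
Qed.

(** Induction on [m]: contexts are the pairs in [P], their children realize exactly the [reachable]
    counts, and [grundy_step] evaluates the mex. *)
Lemma SG_excellent m n w P A : perm_eq w (iota 1 n) ->
  (forall p, p \in P -> is_pointer n p) -> #|` P| = m.*2.+1 ->
  excellent P w -> A `<=` P -> SG w A = grundy m.+1 #|` A|.
Proof.
elim: m n w P A => [|m IHm] n w P A w_perm ptrP cardP exc AP;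
  have [cmpP isoP SPw] := exc; rewrite (SG_eq _ w_perm).
- have [p defP] : exists p, P = [fset p] by apply/cardfs1P; rewrite cardP.
  have pP : p \in P by rewrite defP in_fset1.
  have w_fixed r s : ~~ compatible w r s.
    apply/negP => /(excellent_compatible w_perm exc)[].
    by rewrite defP !in_fset1 => /eqP-> /eqP->; rewrite eqxx.
  have -> : cds_fixed w.
    rewrite /cds_fixed; case E: (contexts w) => [//|c s].
    have /mem_contexts : c \in contexts w by rewrite E mem_head.
    by rewrite (negbTE (w_fixed _ _)).
  have pile0 : pile w != [::].
    by apply/eqP => e; move: pP; rewrite -SPw mem_SP e.
  have [path_w _ _] := pileP pile0.
  have last_p : Cperm w n = p.
    move: path_w; rewrite (size_word w_perm); move: (mem_SP w); rewrite SPw.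
    case: (pile w) pile0 => // y s _ memP /= /andP[/eqP-> _].
    by have := memP y; rewrite mem_head defP in_fset1 => /eqP.
  have [pw _] := pointer_mem w_perm (ptrP _ pP).
  have def_w : w = sigma n p.
    apply: (fixed_sigma w_perm w_fixed (ptrP _ pP)).
    (* Since [n.+1] is absent, [Cperm w n = p] says that the last entry is [p]. *)
    have n1 : index n.+1 w = n.
      by rewrite memNindex ?(size_word w_perm) // (mem_word w_perm) ltnn.
    have := before_eq w_perm pw (leqnn n).
    by rewrite -{1}n1 -(Cperm_gap w_perm) // last_p eqxx => /esym/eqP.
  rewrite /fixed_value (size_word w_perm).
  have [A0|[r rA]] := fset_0Vmem A; first by rewrite A0 cardfs0.
  have rp : r = p by apply/eqP; rewrite -in_fset1 -defP (fsubsetP AP).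
  have -> : A = [fset p].
    apply/eqP; rewrite eqEfsubset -{1}defP AP /=.
    by apply/fsubsetP => s; rewrite in_fset1 => /eqP->; rewrite -rp.
  rewrite cardfs1; have -> // : has (fun a => w == sigma n a) [fset p].
  by apply/hasP; exists p; rewrite ?in_fset1 // {1}def_w.
have cardAB : #|` A| + #|` P `\` A| = m.+1.*2.+1.
  by rewrite -cardP -(cardfsID A P) (fsetIidPr AP).
have [ne ex0 ex1] := grundy_step (ltn0Sn m) cardAB.
have child p q : p \in P -> q \in P -> p != q ->
    SG (cds p q w) (child_set w A p q) =
    grundy m.+1 #|` (P `\` A) `\` [fset p; q]|.
  move=> pP qP npq; have cmp := cmpP _ _ pP qP npq.
  have [w'_perm _ _] := cds_spec w_perm cmp.
  rewrite /child_set SPw; apply: (IHm n _ (P `\` [fset p; q])) => //.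
  - by move=> r; rewrite in_fsetD => /andP[_ /ptrP].
  - by have := card_fsetD2 P npq; rewrite cardP pP qP => -[].
  - exact: (excellent_cds w_perm).
  - by apply: fsetSD; apply: fsubsetDl.
have reach c : reachable #|` A| #|` P `\` A| c ->
    grundy m.+1 c \in [seq SG (cds c.1 c.2 w) (child_set w A c.1 c.2)
                      | c <- contexts w].
  case/(reachable_pairP AP)=> p [q [pP qP npq ->]].
  apply/mapP; exists (p, q); last by rewrite child.
  rewrite mem_filter cmpP //=; apply: allpairs_f; rewrite mem_iota.
    by have := ptrP _ pP; rewrite (size_word w_perm) /is_pointer; clear; lia.
  by have := ptrP _ qP; rewrite (size_word w_perm) /is_pointer; clear; lia.
have le2 : grundy m.+2 #|` A| <= 2 by rewrite /grundy; case: ifP => // _; case: ifP.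
have -> : cds_fixed w = false.
  (* Some pair exists: [k] is 2, 0 or 1 as [A] is empty, has at least two elements, or has one. *)
  have [c /reach] : exists c, reachable #|` A| #|` P `\` A| c.
    case: (ltngtP #|` A| 1) => a1.
    - by exists (#|` P `\` A| - 2); exists 2; split=> //; clear - cardAB a1; lia.
    - by exists #|` P `\` A|; exists 0; split; rewrite ?subn0.
    - by exists (#|` P `\` A| - 1); exists 1; split=> //; clear - cardAB a1; lia.
  by rewrite /cds_fixed; case: (contexts w).
apply: mex_eq.
  apply/mapP=> -[[p q] /mem_contexts /(excellent_compatible w_perm exc)[pP qP npq]] /=.
  rewrite child // => e; apply: (ne _ (reachable_pair AP pP qP npq)).
  by rewrite -e.
(* By [le2] only 0 and 1 have to be attained. *)
case=> [|[|j]] lt_j; last by have := leq_trans lt_j le2.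
  by have [c /reach rc <-] := ex0 lt_j.
by have [c /reach rc <-] := ex1 lt_j.
Qed.

End PointerPairs.

Theorem theorem5p10 (n m a : nat) (P A : {fset nat}) (pi : 'S_n) :
  1 <= m ->
  (forall p, p \in P -> is_pointer n p) ->
  #|` P|%fset = 2 * m - 1 ->
  excellent P (oneline pi) ->
  (A `<=` SP (oneline pi))%fset ->
  #|` A|%fset = a ->
  [/\ (a + 2 <= m \/ (a + 1 = m /\ odd m)) -> SG (oneline pi) A = 0,
      (m + 1 <= a \/ (a = m /\ odd m)) -> SG (oneline pi) A = 1
    & ((a = m \/ a + 1 = m) /\ ~~ odd m) -> SG (oneline pi) A = 2].
Proof.
case: m => // m _ ptrP cardP exc; have [_ _ ->] := exc => AP card_a.
have card_P : #|` P|%fset = m.*2.+1 by rewrite cardP; clear; lia.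
have -> := SG_excellent (oneline_perm pi) ptrP card_P exc AP.
rewrite card_a /grundy; clear; split=> h.
- by case: ifP => //; lia.
- by case: ifP => [|_]; [lia | case: ifP => //; lia].
- by case: ifP => [|_]; [lia | case: ifP => //; lia].
Qed.
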